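(* Let $X_1$ and $X_2$ be $2$-dimensional real normed spaces with $d_{BM}(X_1, \ell_1^2) \geq d_{BM}(X_1,X_2)$ or $d_{BM}(X_2, \ell_1^2) \geq d_{BM}(X_1,X_2)$. Then, for any integer $m \geq 1$, \[ d_{BM}(X_1 \oplus_1 \ell_1^m, X_2 \oplus_1 \ell_1^m) = d_{BM}(X_1,X_2). \]
   Context: $\ell_1^n$ denotes $\mathbb{R}^n$ with the norm $\|x\|_1 = \sum_i |x_i|$. For normed spaces $X, Y$, the sum $X \oplus_1 Y$ is $X \times Y$ with norm $\|(x,y)\| = \|x\|_X + \|y\|_Y$. The Banach--Mazur distance between two real normed spaces $X, Y$ of the same finite dimension is $d_{BM}(X,Y) = \inf \|T\|\,\|T^{-1}\|$, the infimum over all invertible linear operators $T: X \to Y$, with operator norms. *)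

(* Defs.v *)
From HB Require Import structures.
From mathcomp Require Import all_boot all_order all_algebra.
From mathcomp Require Import all_classical all_reals all_analysis.
Set Implicit Arguments.
Unset Strict Implicit.
Unset Printing Implicit Defensive.
Import Order.TTheory GRing.Theory Num.Theory.
Import numFieldNormedType.Exports.
Local Open Scope classical_set_scope.
Local Open Scope ring_scope.

(* An alias, because the library norms ['rV[R]_n] by the maximum. *)
Definition ell1 (R : realType) (n : nat) : Type := 'rV[R]_n.

Section Ell1.
Context (R : realType) (n : nat).

HB.instance Definition _ := GRing.Lmodule.copy (ell1 R n) 'rV[R]_n.

Definition ell1_norm (x : ell1 R n) : R := \sum_(i < n) `|x ord0 i|.

Let ell1_ler_normD (x y : ell1 R n) :
  ell1_norm (x + y) <= ell1_norm x + ell1_norm y.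
Proof.
rewrite /ell1_norm -big_split /=; apply: ler_sum => i _.
by rewrite mxE ler_normD.
Qed.

Let ell1_normrZ (a : R) (x : ell1 R n) :
  ell1_norm (a *: x) = `|a| * ell1_norm x.
Proof.
by rewrite /ell1_norm mulr_sumr; apply: eq_bigr => i _; rewrite mxE normrM.
Qed.

Let ell1_normr0_eq0 (x : ell1 R n) : ell1_norm x = 0 -> x = 0.
Proof.
move=> /eqP; rewrite psumr_eq0 => [/allP x0|i _]; last exact: normr_ge0.
apply/rowP => i; rewrite mxE; apply/eqP; rewrite -normr_eq0.
by apply: x0; rewrite mem_index_enum.
Qed.

HB.instance Definition _ :=
  Lmodule_isNormed.Build R (ell1 R n) ell1_ler_normD ell1_normrZ
    ell1_normr0_eq0.

Lemma ell1_normE (x : ell1 R n) : `|x| = \sum_(i < n) `|x ord0 i|.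
Proof. by []. Qed.

End Ell1.

(* An alias, because the library norms [X * Y] by the maximum. *)
Definition l1sum (R : realType) (X Y : normedModType R) : Type := (X * Y)%type.

Section L1Sum.
Context (R : realType) (X Y : normedModType R).

HB.instance Definition _ := GRing.Lmodule.copy (l1sum X Y) (X * Y)%type.

Definition l1sum_norm (z : l1sum X Y) : R := `|z.1| + `|z.2|.

Let l1sum_ler_normD (x y : l1sum X Y) :
  l1sum_norm (x + y) <= l1sum_norm x + l1sum_norm y.
Proof. by rewrite /l1sum_norm addrACA lerD// ler_normD. Qed.

Let l1sum_normrZ (a : R) (x : l1sum X Y) :
  l1sum_norm (a *: x) = `|a| * l1sum_norm x.
Proof. by rewrite /l1sum_norm mulrDr !normrZ. Qed.

Let l1sum_normr0_eq0 (x : l1sum X Y) : l1sum_norm x = 0 -> x = 0.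
Proof.
case: x => a b /eqP; rewrite /l1sum_norm paddr_eq0//= !normr_eq0.
by move=> /andP[/eqP -> /eqP ->].
Qed.

HB.instance Definition _ :=
  Lmodule_isNormed.Build R (l1sum X Y) l1sum_ler_normD l1sum_normrZ
    l1sum_normr0_eq0.

Lemma l1sum_normE (z : l1sum X Y) : `|z| = `|z.1| + `|z.2|.
Proof. by []. Qed.

End L1Sum.

Definition has_dim (R : realType) (n : nat) (X : normedModType R) : Prop :=
  inhabited (Vector.axiom n X).

(* [sup] of an unbounded set is the junk value [0]; between spaces of finite
   dimension, every linear map is bounded, so this does not occur. *)
Definition opnorm (R : realType) (X Y : normedModType R)
    (T : {linear X -> Y}) : R :=
  sup [set `|T x| | x in [set x : X | `|x| <= 1]].

(* Meaningful when [X] and [Y] have the same finite dimension. *)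
Definition banach_mazur (R : realType) (X Y : normedModType R) : R :=
  inf [set r | exists (T : {linear X -> Y}) (S : {linear Y -> X}),
    [/\ cancel T S, cancel S T & r = opnorm T * opnorm S]].

(* Main.v *)
(* If a single [l1^m]-coordinate of [z] in [X2 + l1^m] carries at least half
   of [|z|], the quotient by the line of [z] is isometric to [X2 + l1^(m-1)].
   Let [T : X1 + l1^m -> X2 + l1^m] be an isomorphism with [|T| <= r < 2] and
   [|T^-1| <= 1]. The first [l1^m]-coordinate of [T z] is 1 at [z = T^-1 e_0],
   so it is at least [|z|], hence at least [|T z| / 2], at some [z] which is
   either some [e_i] or a vector of [X1]. Quotienting by [z] and [T z]
   replaces [m] by [m - 1] on the right; on the left it gives [X1 + l1^(m-1)]
   if [z = e_i], and [(X1 / z) + l1^m = l1^2 + l1^(m-1)] if [z] is in [X1]. By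
   induction, [X1] or [l1^2] is at distance at most [r] from [X2]. The
   restriction [r < 2] is harmless because [d(X2, l1^2) <= 2] by Auerbach's
   lemma. *)
Require Import Defs.
From HB Require Import structures.
From mathcomp Require Import all_boot all_order all_algebra.
From mathcomp Require Import all_classical all_reals all_analysis.
From mathcomp Require Import lra ring.
Import Order.TTheory GRing.Theory Num.Theory.
Import numFieldNormedType.Exports.
Local Open Scope ring_scope.

Set Implicit Arguments.
Unset Strict Implicit.
Unset Printing Implicit Defensive.

(** * Linear maps in coordinates and their boundedness *)

Definition linear_pack (R : realType) (X Y : normedModType R) (f : X -> Y)
    (lf : linear f) : {linear X -> Y} :=
  HB.pack f (GRing.isLinear.Build R X Y *:%R f lf).

Lemma linear_can (R : realType) (X Y : lmodType R) (f : X -> Y) (g : Y -> X) :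
  linear f -> cancel f g -> cancel g f -> linear g.
Proof.
by move=> lf fK gK a u v; rewrite -{1}(gK u) -{1}(gK v) -lf fK.
Qed.

Lemma scalar_scale (R : realType) (X : lmodType R) (f : X -> R) (c : R)
    (x : X) : scalar f -> f (c *: x) = c * f x.
Proof.
move=> lf; have f0 : f 0 = 0.
  by have := lf 1 0 0; rewrite scaler0 addr0 mul1r; lra.
by rewrite -[c *: x]addr0 lf f0 addr0.
Qed.

Lemma ord2_cases (i : 'I_2) : i = 0 \/ i = 1.
Proof. by case: i => -[|[|//]] ?; [left|right]; exact/val_inj. Qed.

Lemma has_dimP (R : realType) (n : nat) (X : normedModType R) :
  has_dim n X -> exists (h : 'rV[R]_n -> X) (g : X -> 'rV[R]_n),
  [/\ linear h, linear g, cancel h g & cancel g h].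
Proof.
case=> -[g lg [h gK hK]]; exists h, g; split=> //.
exact: linear_can lg gK hK.
Qed.

Lemma ler_coord_norm (R : realType) (n : nat) (v : 'rV[R]_n) (i : 'I_n) :
  `|v 0 i| <= `|v|.
Proof.
rewrite [leRHS]/Num.Def.normr /= mx_normrE; apply/bigmax_geP; right => /=.
by exists (0, i).
Qed.

Lemma linear_rV_bounded (R : realType) (n : nat) (Y : normedModType R)
    (h : {linear 'rV[R]_n -> Y}) :
  exists2 C : R, 0 <= C & forall v, `|h v| <= C * `|v|.
Proof.
exists (\sum_i `|h (delta_mx 0 i)|); first exact: sumr_ge0.
move=> v; rewrite {1}(row_sum_delta v) linear_sum mulr_suml.
apply: le_trans (ler_norm_sum _ _ _) _; apply: ler_sum => i _.
rewrite linearZ/= normrZ mulrC ler_wpM2l//.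
exact: ler_coord_norm.
Qed.

(** Equivalence of norms: [|h v|] attains a positive minimum on the unit sphere of the maximum norm,
    which is compact, and the inverse of that minimum bounds [g]. *)
Lemma coord_bounded (R : realType) (n : nat) (X : normedModType R)
    (h : 'rV[R]_n -> X) (g : X -> 'rV[R]_n) :
  linear h -> cancel h g -> cancel g h ->
  exists2 C : R, 0 <= C & forall x, `|g x| <= C * `|x|.
Proof.
move=> lh hK gK; have lg := linear_can lh hK gK.
pose H := linear_pack lh; pose G := linear_pack lg.
have H0 : h 0 = 0 by exact: (linear0 H).
have G0 : g 0 = 0 by exact: (linear0 G).
(* Without a nonzero vector the sphere is empty and no minimum exists; then [g] vanishes and [C = 0]
   serves. *)
have [[v v0]|all0] := pselect (exists v : 'rV[R]_n, v != 0); last first.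
  exists 0 => // x; have -> : g x = 0; last by rewrite normr0 mul0r.
  by apply: contrapT => /eqP gx; apply: all0; exists (g x).
pose A : set 'rV[R]_n := [set v | `|v| = 1]%classic.
have cA : compact A.
  apply: bounded_closed_compact.
    by exists 1; split=> // M M1 w /= ->; exact: ltW.
  apply: (@closed_comp _ _ (fun w : 'rV[R]_n => `|w|) [set 1]%classic).
    by move=> w _; exact: norm_continuous.
  exact: closed_eq.
have A0 : (A !=set0)%classic.
  exists (`|v|^-1 *: v); rewrite /A/= normrZ normfV normr_id.
  by rewrite mulVf// normr_eq0.
have cH : {within A, continuous (fun w => `|H w|)}%classic.
  apply: continuous_subspaceT => w.
  apply: continuous_comp; last exact: norm_continuous.
  apply: bounded_linear_continuous.
  have [C C0 HC] := linear_rV_bounded H.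
  apply/linear_boundedP; near=> M => x; apply: le_trans (HC x) _.
  by apply: ler_wpM2r => //; near: M; exact: nbhs_pinfty_ge.
have [c /[!inE] cA1 cmin] := EVT_min_rV A0 cA cH.
have c0 : 0 < `|H c|.
  rewrite normr_gt0; apply/eqP => hc0.
  have : c = 0 by rewrite -(hK c) -[h c]/(H c) hc0 G0.
  by move=> c0; move: cA1; rewrite /A/= c0 normr0 => /esym/eqP; rewrite oner_eq0.
exists `|H c|^-1; first by rewrite invr_ge0 ltW.
move=> x; have [gx0|gx0] := eqVneq (g x) 0.
  by rewrite gx0 normr0 mulr_ge0 ?invr_ge0.
rewrite -ler_pdivrMl ?invr_gt0// invrK.
have gxp : 0 < `|g x| by rewrite normr_gt0.
have /cmin : `|g x|^-1 *: g x \in A.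
  by rewrite inE /A/= normrZ normfV normr_id mulVf// normr_eq0.
rewrite linearZ/= normrZ normfV normr_id gK mulrC.
by rewrite ler_pdivlMr.
Unshelve. all: by end_near. Qed.

Lemma linear_bounded (R : realType) (n : nat) (X Y : normedModType R)
    (f : {linear X -> Y}) :
  has_dim n X -> exists2 C : R, 0 <= C & forall x, `|f x| <= C * `|x|.
Proof.
move=> /has_dimP[h [g [lh lg hK gK]]].
have [C C0 HC] := coord_bounded lh hK gK.
have lfh : linear (f \o h) by move=> a u v; rewrite /= lh linearP.
have [D D0 HD] := linear_rV_bounded (linear_pack lfh).
exists (D * C); first exact: mulr_ge0.
move=> x; have := HD (g x) => /= ; rewrite gK => /le_trans; apply.
by rewrite -mulrA ler_wpM2l.
Qed.

(** * The area form of a plane, and almost maximizers *)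

(* [area] is the determinant in a basis; the fourth property is Cramer's
   rule. *)
Lemma area_form (R : realType) (X : normedModType R) :
  has_dim 2 X -> exists2 area : X -> X -> R,
  [/\ forall x, scalar (area x), forall x y, area x y = - area y x,
    forall x, x != 0 -> exists y, area x y != 0 &
    forall x y z, area x y *: z = area z y *: x + area x z *: y] &
  (exists2 C, 0 <= C & forall x y, `|area x y| <= C * (`|x| * `|y|)) /\
  exists x : X, x != 0.
Proof.
move=> /has_dimP[h [g [lh lg hK gK]]].
have [C C0 HC] := coord_bounded lh hK gK.
pose H := linear_pack lh; pose G := linear_pack lg.
have gP a u v i : g (a *: u + v) 0 i = a * g u 0 i + g v 0 i.
  by rewrite lg !mxE.
exists (fun x y => g x 0 0 * g y 0 1 - g x 0 1 * g y 0 0).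
  split.
  - by move=> x a u v; rewrite !gP; ring.
  - by move=> x y; ring.
  - move=> x x0.
    have : g x != 0.
      apply: contra_neq x0 => gx0; rewrite -(gK x) gx0; exact: (linear0 H).
    have [gx0|gx0] := eqVneq (g x 0 0) 0.
      have [gx1|gx1 _] := eqVneq (g x 0 1) 0.
        case/eqP; apply/rowP => i; rewrite mxE.
        by case: (ord2_cases i) => ->.
      exists (h (delta_mx 0 0)); rewrite hK !mxE/= mulr0 mulr1 sub0r.
      by rewrite oppr_eq0.
    exists (h (delta_mx 0 1)); rewrite hK !mxE/= mulr0 mulr1 subr0.
    by [].
  - move=> x y z; apply: (can_inj gK); apply/rowP => i.
    have gZ a u j : g (a *: u) 0 j = a * g u 0 j.
      by rewrite -[a *: u]addr0 gP [g 0](linear0 G) mxE addr0.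
    by case: (ord2_cases i) => ->; rewrite gP !gZ; ring.
split.
  have gC x i : `|g x 0 i| <= C * `|x|.
    exact: le_trans (ler_coord_norm _ _) (HC x).
  exists (C * C + C * C); first by rewrite addr_ge0// mulr_ge0.
  move=> x y; apply: le_trans (ler_normB _ _) _; rewrite !normrM mulrDl.
  by apply: lerD; rewrite mulrACA; apply: ler_pM.
exists (h (delta_mx 0 0)); apply/eqP => h0.
have := hK (delta_mx 0 0); rewrite h0 [g _](linear0 G) => /matrixP/(_ 0 0).
by rewrite !mxE => /esym/eqP; rewrite oner_eq0.
Qed.

(** The supremum is positive, so it exceeds its quotient by [a], and some value lies between the
    two. A maximizer up to the factor [a] replaces an attained maximum in the extremal problems
    below; the results then hold for every [a > 1], and [a] is finally taken close to 1. *)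
Lemma almost_max (R : realType) (I : Type) (f : I -> R) (C a : R) (i0 : I) :
  (forall i, f i <= C) -> 0 < f i0 -> 1 < a ->
  exists2 i, 0 < f i & forall j, f j <= a * f i.
Proof.
move=> fC f0 a1.
have hs : has_sup (range f).
  by split; [exists (f i0), i0|exists C => _ [i _ <-]].
have le_sup j : f j <= sup (range f).
  by apply: sup_upper_bound hs _ _; exists j.
have s0 : 0 < sup (range f) := lt_le_trans f0 (le_sup i0).
have a0 : 0 < a by apply: lt_trans a1.
have [_ [i _ <-] lt_i] : exists2 y, range f y & sup (range f) / a < y.
  have [|y ry] := @sup_adherent _ _ (sup (range f) - sup (range f) / a) _ hs.
    by rewrite subr_gt0 ltr_pdivrMr// ltr_pMr.
  by rewrite opprB addrCA subrr addr0; exists y.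
exists i; first by apply: lt_trans lt_i; rewrite divr_gt0.
move=> j; apply: le_trans (le_sup j) _.
by rewrite mulrC -ler_pdivrMr// ltW.
Qed.

(** * Normalized isomorphisms and the Banach-Mazur distance *)

(** The whole distortion is put on [T], and its inverse is a contraction; scaling [T] achieves this.
    A single number [r] then follows the pair through quotients and sums. *)
Definition iso_within (R : realType) (r : R) (X Y : normedModType R) : Prop :=
  exists (T : {linear X -> Y}) (S : {linear Y -> X}),
  [/\ cancel T S, cancel S T, forall x, `|T x| <= r * `|x| &
      forall y, `|S y| <= `|y|].

Lemma iso_withinI (R : realType) (r : R) (X Y : normedModType R) (f : X -> Y)
    (g : Y -> X) : linear f -> cancel f g -> cancel g f ->
  (forall x, `|f x| <= r * `|x|) -> (forall y, `|g y| <= `|y|) ->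
  iso_within r X Y.
Proof.
move=> lf fK gK fr g1.
by exists (linear_pack lf), (linear_pack (linear_can lf fK gK)).
Qed.

Lemma iso_within_ge1 (R : realType) (r : R) (X Y : normedModType R) (x : X) :
  x != 0 -> iso_within r X Y -> 1 <= r.
Proof.
move=> x0 [T [S [TK SK Tr S1]]]; rewrite -(@ler_pM2r _ `|x|) ?normr_gt0//.
by rewrite mul1r -{1}(TK x); apply: le_trans (S1 _) (Tr x).
Qed.

Lemma opnorm_le (R : realType) (X Y : normedModType R) (T : {linear X -> Y})
    (C : R) :
  0 <= C -> (forall x, `|T x| <= C * `|x|) -> opnorm T <= C.
Proof.
move=> C0 TC; apply: ge_sup => [|_ [x /= x1 <-]].
  by exists `|T 0|, 0 => //=; rewrite normr0.
by apply: le_trans (TC x) _; rewrite ler_piMr.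
Qed.

Lemma le_opnorm (R : realType) (X Y : normedModType R) (T : {linear X -> Y})
    (C : R) (x : X) :
  0 <= C -> (forall x, `|T x| <= C * `|x|) -> `|T x| <= opnorm T * `|x|.
Proof.
move=> C0 TC; have [->|x0] := eqVneq x 0; first by rewrite linear0 !normr0 mulr0.
have xp : 0 < `|x| by rewrite normr_gt0.
rewrite -ler_pdivrMr//; apply: ub_le_sup.
  by exists C => _ [y /= y1 <-]; apply: le_trans (TC y) _; rewrite ler_piMr.
exists (`|x|^-1 *: x) => /=.
  by rewrite normrZ normfV normr_id mulVf// gt_eqF.
by rewrite linearZ/= normrZ normfV normr_id mulrC.
Qed.

Lemma opnorm_ge0 (R : realType) (X Y : normedModType R) (T : {linear X -> Y}) :
  0 <= opnorm T.
Proof.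
rewrite /opnorm; set E := image _ _.
(* If the set has no supremum, [sup] is 0 by convention, and the bound still holds. *)
have [supE|/sup_out ->//] := pselect (has_sup E).
apply: (sup_upper_bound supE); exists 0 => /=; first by rewrite normr0.
by rewrite linear0 normr0.
Qed.

Lemma banach_mazur_le (R : realType) (X Y : normedModType R)
    (T : {linear X -> Y}) (S : {linear Y -> X}) :
  cancel T S -> cancel S T -> banach_mazur X Y <= opnorm T * opnorm S.
Proof.
move=> TK SK; apply: ge_inf; last by exists T, S.
by exists 0 => _ [T' [S' [_ _ ->]]]; rewrite mulr_ge0// opnorm_ge0.
Qed.

Lemma banach_mazur_le_within (R : realType) (r : R) (X Y : normedModType R) :
  0 <= r -> iso_within r X Y -> banach_mazur X Y <= r.
Proof.
move=> r0 [T [S [TK SK Tr S1]]].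
apply: le_trans (banach_mazur_le TK SK) _; rewrite -[leRHS]mulr1.
apply: ler_pM; rewrite ?opnorm_ge0 ?opnorm_le// => y.
by rewrite mul1r.
Qed.

Lemma banach_mazurC (R : realType) (X Y : normedModType R) :
  banach_mazur X Y = banach_mazur Y X.
Proof.
by congr inf; apply/seteqP; split=> _ [T [S [TK SK ->]]]; exists S, T;
  split=> //; rewrite mulrC.
Qed.

(** Scaling [T] by [opnorm S] and [S] by its inverse keeps the product of norms and makes the
    inverse map a contraction. The nonzero vector [x] excludes [opnorm S = 0]; the bounds [C] and
    [D] ensure that both operator norms are true suprema. *)
Lemma iso_within_opnorm (R : realType) (X Y : normedModType R)
    (T : {linear X -> Y}) (S : {linear Y -> X}) (C D : R) (x : X) :
  x != 0 -> cancel T S -> cancel S T ->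
  0 <= C -> (forall x, `|T x| <= C * `|x|) ->
  0 <= D -> (forall y, `|S y| <= D * `|y|) ->
  iso_within (opnorm T * opnorm S) X Y.
Proof.
move=> x0 TK SK C0 TC D0 SD.
have S0 : 0 < opnorm S.
  rewrite lt_neqAle opnorm_ge0 andbT; apply: contraNneq x0 => s0.
  by rewrite -(TK x) -normr_le0 (le_trans (le_opnorm _ D0 SD))// -s0 mul0r.
have Sn0 : opnorm S != 0 by rewrite gt_eqF.
apply: (@iso_withinI _ _ _ _ (fun x => opnorm S *: T x)
  (fun y => S ((opnorm S)^-1 *: y))).
- by move=> a u v; rewrite linearP scalerDr !scalerA mulrC.
- by move=> u; rewrite scalerA mulVf// scale1r TK.
- by move=> u; rewrite SK scalerA mulfV// scale1r.
- move=> u; rewrite normrZ gtr0_norm// mulrAC mulrC ler_wpM2r ?opnorm_ge0//.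
  exact: le_opnorm C0 TC.
- move=> y; apply: le_trans (le_opnorm _ D0 SD) _.
  by rewrite normrZ normfV gtr0_norm// mulrA mulfV// mul1r.
Qed.

(** * Quotients by a line *)

(* Up to the distortion [a], [W] is the quotient of [Z] by the line of [z]. *)
Definition line_quotient (R : realType) (a : R) (Z W : normedModType R)
    (z : Z) : Prop :=
  exists (p : {linear Z -> W}) (i : {linear W -> Z}),
  [/\ p z = 0, cancel i p, forall v, exists c, i (p v) = v + c *: z,
      forall v, `|p v| <= `|v| & forall w, `|i w| <= a * `|w|].

(** [T] carries the line of [z] to the line of [T z], so it induces an isomorphism of the quotients.
    The lift [i1] costs the factor [a] in one direction; the lift [i2] costs nothing, so the induced
    inverse remains a contraction. *)
Lemma iso_within_quotient (R : realType) (r a : R)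
    (Z1 Z2 W1 W2 : normedModType R)
    (T : {linear Z1 -> Z2}) (S : {linear Z2 -> Z1}) (z : Z1) :
  0 <= r -> cancel T S -> cancel S T ->
  (forall x, `|T x| <= r * `|x|) -> (forall y, `|S y| <= `|y|) ->
  line_quotient a W1 z -> line_quotient 1 W2 (T z) -> iso_within (r * a) W1 W2.
Proof.
move=> r0 TK SK Tr S1 [p1 [i1 [pz1 pK1 ip1 np1 ni1]]].
move=> [p2 [i2 [pz2 pK2 ip2 np2 ni2]]].
apply: (@iso_withinI _ _ _ _ (p2 \o T \o i1) (p1 \o S \o i2)) => /=.
- by move=> c u v; rewrite /= !linearP.
- move=> w /=; have [c ->] := ip2 (T (i1 w)).
  by rewrite linearD linearZ/= !TK linearD linearZ/= pz1 scaler0 addr0.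
- move=> w /=; have [c ->] := ip1 (S (i2 w)).
  by rewrite linearD linearZ/= SK linearD linearZ/= pz2 scaler0 addr0.
- move=> w; apply: le_trans (np2 _) _; apply: le_trans (Tr _) _.
  by rewrite -mulrA ler_wpM2l.
- move=> w; apply: le_trans (np1 _) _; apply: le_trans (S1 _) _.
  by rewrite -[leRHS]mul1r.
Qed.

Lemma has_dim_ell1 (R : realType) (n : nat) : has_dim n (ell1 R n).
Proof. by constructor; exists (id : ell1 R n -> 'rV[R]_n) => //; exists id. Qed.

Lemma has_dim_l1sum (R : realType) (X : normedModType R) (n m : nat) :
  has_dim n X -> has_dim (n + m) (l1sum X (ell1 R m)).
Proof.
move=> /has_dimP[h [g [lh lg hK gK]]]; constructor.
exists (fun z : l1sum X (ell1 R m) => row_mx (g z.1) z.2).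
  by move=> a u v; rewrite /= lg scale_row_mx add_row_mx.
exists (fun v => (h (lsubmx v), rsubmx v)) => [[x t]|v] /=.
  by rewrite row_mxKl row_mxKr gK.
by rewrite hK hsubmxK.
Qed.

(** The quotient is realized as the hyperplane where coordinate [j] vanishes, with projection
    [v - c z] for [c = v_j / z_j]. Removing coordinate [j] saves [|v_j| = |c| |z_j|], while the
    other components of [c z] add at most [|c| (|z| - |z_j|)]. By hypothesis this is no more than
    the saving, so the projection is a contraction. *)
Lemma cone_quotient (R : realType) (X : normedModType R) (m : nat)
    (z : l1sum X (ell1 R m.+1)) (j : 'I_m.+1) :
  z != 0 -> `|z| <= 2 * `|z.2 ord0 j| ->
  line_quotient 1 (l1sum X (ell1 R m)) z.
Proof.
move=> z0 zj.
have zj0 : z.2 ord0 j != 0.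
  apply: contra_neq z0 => zj0; apply/eqP.
  by rewrite -normr_le0 (le_trans zj)// zj0 normr0 mulr0.
pose sub (v : l1sum X (ell1 R m.+1)) := v - (v.2 ord0 j / z.2 ord0 j) *: z.
pose p v : l1sum X (ell1 R m) :=
  ((sub v).1, \row_k (sub v).2 ord0 (lift j k)).
pose i (w : l1sum X (ell1 R m)) : l1sum X (ell1 R m.+1) :=
  (w.1, \row_k oapp (w.2 ord0) 0 (unlift j k)).
have lp : linear p.
  move=> c u v; congr pair; last first.
    by apply/rowP => k; rewrite !mxE; field.
  rewrite /sub /= scalerBr scalerA !mxE !mulrDl scalerDl opprD.
  by rewrite addrACA mulrA.
have li : linear i.
  move=> c u v; congr pair; apply/rowP => k; rewrite !mxE.
  by case: unliftP => /= [k' _|_]; rewrite ?mxE ?mulr0 ?addr0.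
exists (linear_pack lp), (linear_pack li); split => /=.
- congr pair; first by rewrite /= divff// scale1r subrr.
  by apply/rowP => k; rewrite !mxE divff// mul1r subrr.
- case=> x t; rewrite /p /i /sub /= !mxE unlift_none/= mul0r scale0r subr0.
  by congr pair; apply/rowP => k; rewrite !mxE liftK mul0r subr0.
- move=> v; exists (- (v.2 ord0 j / z.2 ord0 j)).
  rewrite scaleNr -/(sub v) /i /p /=.
  rewrite [RHS]surjective_pairing; congr pair; apply/rowP => k; rewrite mxE.
  case: unliftP => [k' ->|->] /=; rewrite !mxE//.
  by rewrite divfK// subrr.
- move=> v; rewrite !l1sum_normE !ell1_normE/= (bigD1_ord j)//=.
  set c := _ / _.
  have cz : `|c| * `|z.2 ord0 j| = `|v.2 ord0 j|.
    by rewrite -normrM /c divfK.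
  move: zj; rewrite l1sum_normE ell1_normE (bigD1_ord j)//= => zj.
  have le1 : `|v.1 - c *: z.1| <= `|v.1| + `|c| * `|z.1|.
    by rewrite -normrZ ler_normB.
  have le2 : \sum_(k < m) `|(\row_k (sub v).2 ord0 (lift j k)) ord0 k| <=
      \sum_(k < m) `|v.2 ord0 (lift j k)| +
      `|c| * \sum_(k < m) `|z.2 ord0 (lift j k)|.
    rewrite mulr_sumr -big_split; apply: ler_sum => k _ /=.
    by rewrite !mxE -normrM ler_normB.
  apply: le_trans (lerD le1 le2) _; rewrite addrACA -mulrDr [leRHS]addrCA addrC.
  rewrite lerD2r -cz ler_wpM2l//; lra.
- move=> w; rewrite mul1r !l1sum_normE !ell1_normE/= (bigD1_ord j)//=.
  rewrite lerD2l mxE unlift_none/= normr0 add0r.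
  by apply: ler_sum => k _; rewrite mxE liftK.
Qed.

(** The functional is the area with [x], scaled by its value at an almost maximizer of
    [|D x v| / |v|]. It identifies the quotient of [X] by the line of [x] with the real line up to
    the factor [a]. *)
Lemma almost_norming (R : realType) (X : normedModType R) (x : X) (a : R) :
  has_dim 2 X -> x != 0 -> 1 < a ->
  exists2 phi : X -> R, scalar phi /\ phi x = 0 & exists y,
  [/\ phi y = 1, `|y| <= a, forall v, `|phi v| <= `|v| &
      forall v, exists c, phi v *: y = v + c *: x].
Proof.
move=> /area_form[D [Dl Dxy Dn0 DC] [[C C0 HC] _]] x0 a1.
have Dxx v : D v v = 0 by have := Dxy v v; lra.
have Ds u c v : D u (c *: v) = c * D u v := scalar_scale c v (Dl u).
have a0 : 0 < a by exact: lt_trans a1.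
have [y0 xy0] := Dn0 _ x0.
(* Division by 0 gives [f 0 = 0], so a positive value of [f] forces a nonzero vector. *)
pose f v := `|D x v| / `|v|.
have Dn v w : D v w != 0 -> w != 0.
  by apply: contra_neq => ->; rewrite -(scale0r 0) Ds mul0r.
have fle v : f v <= C * `|x|.
  have [->|v0] := eqVneq v 0.
    by rewrite /f normr0 invr0 mulr0 mulr_ge0.
  by rewrite ler_pdivrMr ?normr_gt0// -mulrA.
have fy0 : 0 < f y0 by rewrite /f divr_gt0 ?normr_gt0//; exact: Dn xy0.
have [y fy fmax] := almost_max fle fy0 a1.
have y0' : y != 0.
  by apply: contraTneq fy => ->; rewrite /f normr0 invr0 mulr0 ltxx.
have yp : 0 < `|y| by rewrite normr_gt0.
(* Norm [a] rather than 1: then [|D x y'| = a * f y] dominates every [f v], which makes the scaled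
   functional a contraction. *)
pose y' := (a / `|y|) *: y.
have Dy' : `|D x y'| = a * f y.
  by rewrite Ds normrM normrM normfV normr_id (gtr0_norm a0) /f; ring.
have ny' : `|y'| = a.
  by rewrite normrZ normrM normfV normr_id divfK ?gt_eqF// gtr0_norm.
clearbody y'.
have Dy'p : 0 < `|D x y'| by rewrite Dy' mulr_gt0.
have Dy'0 : D x y' != 0 by rewrite -normr_gt0.
exists (fun v => D x v / D x y').
  split; last by rewrite Dxx mul0r.
  by move=> c u v; rewrite Dl mulrDl mulrA.
exists y'; split.
- by rewrite divff.
- by rewrite ny'.
- move=> v; rewrite normrM normfV ler_pdivrMr//.
  have [->|v0] := eqVneq v 0; first by rewrite -(scale0r 0) Ds mul0r normr0 mulr_ge0.
  by rewrite mulrC -ler_pdivrMr ?normr_gt0// Dy'; exact: fmax.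
(* The coefficient comes from Cramer's rule for [v] in the basis [x], [y']. *)
- move=> v; exists (- (D v y' / D x y')).
  have mulK c : D x y' * (c / D x y') = c by rewrite mulrC divfK.
  apply: (scalerI Dy'0); rewrite scalerDr !scalerA mulrN !mulK.
  by rewrite (DC x y' v) scaleNr addrAC subrr add0r.
Qed.

(** The one-dimensional quotient of [X] by [x], read through [phi], joins the first coordinate of
    [ell1 R m.+1] to form [ell1 R 2]; the other coordinates form [ell1 R m]. Only lifting along [y],
    whose norm is at most [a], costs a factor. *)
Lemma plane_quotient (R : realType) (X : normedModType R) (m : nat) (x : X)
    (a : R) :
  has_dim 2 X -> x != 0 -> 1 < a ->
  line_quotient a (l1sum (ell1 R 2) (ell1 R m))
    ((x, 0) : l1sum X (ell1 R m.+1)).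
Proof.
move=> dX x0 a1.
have [phi [lphi phix] [y [phiy ya phin phiK]]] := almost_norming dX x0 a1.
pose p (v : l1sum X (ell1 R m.+1)) : l1sum (ell1 R 2) (ell1 R m) :=
  (\row_k (if k == 0 then phi v.1 else v.2 ord0 ord0),
   \row_k v.2 ord0 (lift ord0 k)).
pose i (w : l1sum (ell1 R 2) (ell1 R m)) : l1sum X (ell1 R m.+1) :=
  (w.1 ord0 0 *: y, \row_k oapp (w.2 ord0) (w.1 ord0 1) (unlift ord0 k)).
have lp : linear p.
  move=> c u v; congr pair; apply/rowP => k; rewrite !mxE//.
  by case: ifP => // _; rewrite /= lphi.
have li : linear i.
  move=> c u v; congr pair.
    by rewrite /= !mxE scalerDl scalerA.
  apply/rowP => k; rewrite !mxE.
  by case: unliftP => /= [k' _|_]; rewrite ?mxE.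
have phiZ c : phi (c *: y) = c.
  by rewrite scalar_scale// phiy mulr1.
exists (linear_pack lp), (linear_pack li); split => /=.
- congr pair; apply/rowP => k; rewrite !mxE//.
  by case: ifP; rewrite ?phix.
- case=> s t; rewrite /p /i /=; congr pair; apply/rowP => k; rewrite !mxE.
    by case: (ord2_cases k) => ->; rewrite /= ?phiZ// unlift_none.
  by rewrite liftK.
- case=> v t; have [c Hc] := phiK v; exists c; congr pair.
    by rewrite /= !mxE.
  apply/rowP => k; rewrite !mxE/= mulr0 addr0.
  by case: unliftP => /= [k' ->|->]; rewrite ?mxE.
- move=> v; rewrite !l1sum_normE !ell1_normE/=.
  rewrite [in leRHS]big_ord_recl [in leLHS]big_ord_recl big_ord1 !mxE/=.
  rewrite -addrA; apply: lerD; first exact: phin.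
  by rewrite lerD2l; apply: ler_sum => k _; rewrite mxE.
- move=> w; rewrite !l1sum_normE !ell1_normE/=.
  rewrite [in leLHS]big_ord_recl [in leRHS]big_ord_recl big_ord1.
  rewrite normrZ !mxE unlift_none/=.
  under eq_bigr do rewrite mxE liftK/=.
  rewrite addrA mulrDr mulrDr; apply: lerD; last first.
    by rewrite ler_peMl ?sumr_ge0// ltW.
  apply: lerD; first by rewrite mulrC ler_wpM2r.
  by rewrite (_ : lift _ _ = 1); [rewrite ler_peMl// ltW|exact/val_inj].
Qed.

(** * Auerbach's bound for planes *)

(** Take unit vectors [u'], [v'] whose area is maximal up to the factor [a]. By Cramer's rule the
    coordinates of [y] in this basis are ratios of areas, each at most [a * |y|], so the coordinate
    map has norm at most [2 * a]; its inverse is a contraction by the triangle inequality. *)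
Lemma banach_mazur_ell1_le2 (R : realType) (X : normedModType R) :
  has_dim 2 X -> banach_mazur X (ell1 R 2) <= 2.
Proof.
move=> /area_form[D [Dl Dxy Dn0 DC] [[C C0 HC] [x x0]]].
have Ds u c v : D u (c *: v) = c * D u v := scalar_scale c v (Dl u).
have Ds' u c v : D (c *: u) v = c * D u v by rewrite Dxy Ds (Dxy u v) mulrN.
have Dxx v : D v v = 0 by have := Dxy v v; lra.
have D0 u : D u 0 = 0 by rewrite -(scale0r 0) Ds mul0r.
have D0' u : D 0 u = 0 by rewrite Dxy D0 oppr0.
apply/ler_addgt0Pr => e e0.
pose a := 1 + e / 2.
have a1 : 1 < a by rewrite ltrDl divr_gt0.
have -> : 2 + e = 2 * a by rewrite /a; field.
pose f (b : X * X) := `|D b.1 b.2| / (`|b.1| * `|b.2|).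
have fle b : f b <= C.
  have [b0|] := eqVneq (`|b.1| * `|b.2|) 0; first by rewrite /f b0 invr0 mulr0.
  by move=> b0; rewrite /f ler_pdivrMr// lt_neqAle eq_sym b0 mulr_ge0.
have [y0 xy0] := Dn0 _ x0.
have [|[u v] fuv fmax] := @almost_max _ _ f C a (x, y0) fle _ a1.
  rewrite /f /= divr_gt0 ?mulr_gt0 ?normr_gt0//.
  by apply: contra_neq xy0 => ->.
have u0 : u != 0.
  by apply: contraTneq fuv => ->; rewrite /f /= normr0 mul0r invr0 mulr0 ltxx.
have v0 : v != 0.
  by apply: contraTneq fuv => ->; rewrite /f /= normr0 mulr0 invr0 mulr0 ltxx.
have {}u0 : 0 < `|u| by rewrite normr_gt0.
have {}v0 : 0 < `|v| by rewrite normr_gt0.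
pose u' := `|u|^-1 *: u; pose v' := `|v|^-1 *: v.
have nu : `|u'| = 1 by rewrite normrZ normfV normr_id mulVf// gt_eqF.
have nv : `|v'| = 1 by rewrite normrZ normfV normr_id mulVf// gt_eqF.
have fuv' : f (u, v) = `|D u' v'|.
  rewrite Ds Ds' !normrM !normfV !normr_id /f /=; field.
  by rewrite !gt_eqF.
clearbody u' v'.
have Duv : 0 < `|D u' v'| by rewrite -fuv'.
have Duv0 : D u' v' != 0 by rewrite -normr_gt0.
have Dle y z : `|D y z| <= a * `|D u' v'| * (`|y| * `|z|).
  have [->|y1] := eqVneq y 0; first by rewrite D0' !normr0 mul0r mulr0.
  have [->|z1] := eqVneq z 0; first by rewrite D0 !normr0 !mulr0.
  rewrite -ler_pdivrMr ?mulr_gt0 ?normr_gt0// -fuv'; exact: (fmax (y, z)).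
apply: banach_mazur_le_within; first by rewrite mulr_ge0// ltW// (lt_trans _ a1).
pose g (y : X) : ell1 R 2 :=
  \row_k (if k == 0 then D y v' / D u' v' else D u' y / D u' v').
pose h (s : ell1 R 2) : X := s ord0 0 *: u' + s ord0 1 *: v'.
have mulK c : D u' v' * (c / D u' v') = c by rewrite mulrC divfK.
apply: (@iso_withinI _ _ _ _ g h).
- move=> c y z; apply/rowP => k; rewrite !mxE.
  case: ifP => _; rewrite ?Dl; last by rewrite mulrDl mulrA.
  by rewrite ![D _ v']Dxy Dl; ring.
- move=> y; rewrite /h /g !mxE/=; apply: (scalerI Duv0).
  by rewrite scalerDr !scalerA !mulK -DC.
- move=> s; apply/rowP => k; rewrite !mxE /h.
  have Dr y z c d w : D w (c *: y + d *: z) = c * D w y + d * D w z.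
    by rewrite Dl Ds.
  case: (ord2_cases k) => -> /=; last by rewrite Dr Dxx mulr0 add0r mulfK.
  by rewrite Dxy Dr Dxx mulr0 addr0 Dxy mulrN opprK mulfK.
- move=> y; rewrite ell1_normE big_ord_recl big_ord1 !mxE/=.
  rewrite !normrM !normfV -mulrDl ler_pdivrMr//.
  have := Dle y v'; have := Dle u' y; rewrite nu nv mulr1 mul1r.
  nra.
- move=> s; apply: le_trans (ler_normD _ _) _.
  rewrite !normrZ nu nv !mulr1 ell1_normE big_ord_recl big_ord1.
  by rewrite (_ : lift _ _ = 1)//; exact/val_inj.
Qed.

(** * Adding and removing the [ell1] summand *)

(** [T] is extended by the identity of [W], which meets the bound [r] because [1 <= r]. *)
Lemma iso_within_l1sum (R : realType) (r : R) (X Y W : normedModType R) :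
  1 <= r -> iso_within r X Y -> iso_within r (l1sum X W) (l1sum Y W).
Proof.
move=> r1 [T [S [TK SK Tr S1]]].
apply: (@iso_withinI _ _ _ _ (fun z : l1sum X W => (T z.1, z.2) : l1sum Y W)
  (fun z => (S z.1, z.2))).
- by move=> a u v; rewrite /= linearP.
- by case=> x w /=; rewrite TK.
- by case=> x w /=; rewrite SK.
- move=> z; rewrite !l1sum_normE/= mulrDr.
  by apply: lerD; [exact: Tr|rewrite ler_peMl].
- by move=> z; rewrite !l1sum_normE/= lerD2r.
Qed.

Lemma iso_within_l1sum0 (R : realType) (r : R) (X Y : normedModType R) :
  iso_within r (l1sum X (ell1 R 0)) (l1sum Y (ell1 R 0)) -> iso_within r X Y.
Proof.
move=> [T [S [TK SK Tr S1]]].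
have pairE (Z : normedModType R) (z : l1sum Z (ell1 R 0)) : (z.1, 0) = z.
  by case: z => x t; congr pair; apply/rowP => -[].
have norm0 (Z : normedModType R) (z : l1sum Z (ell1 R 0)) : `|z| = `|z.1|.
  by rewrite l1sum_normE ell1_normE big_ord0 addr0.
pose i (Z : normedModType R) (x : Z) : l1sum Z (ell1 R 0) := (x, 0).
have il Z a u v : @i Z (a *: u + v) = a *: i Z u + i Z v.
  by congr pair; rewrite /= scaler0 addr0.
apply: (@iso_withinI _ _ _ _ (fun x => (T (i _ x)).1) (fun y => (S (i _ y)).1)).
- by move=> a u v; rewrite il linearP.
- by move=> x; rewrite /i pairE TK.
- by move=> y; rewrite /i pairE SK.
- by move=> x; rewrite -norm0; apply: le_trans (Tr _) _; rewrite norm0.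
- by move=> y; rewrite -norm0; apply: le_trans (S1 _) _; rewrite norm0.
Qed.

(** * Induction on the number of [ell1] coordinates *)

(** Let [lam] be the first [ell1] coordinate of [T]. The norm is additive over [X1] and the
    coordinate axes, so if [|lam|] were strictly below the norm at each nonzero vector of [X1] and
    at each [e_i], it would be so at every nonzero vector. But [S e] has norm at most 1 and
    [lam (S e) = 1]. *)
Lemma cone_vector (R : realType) (X1 X2 : normedModType R) (m : nat)
    (T : {linear l1sum X1 (ell1 R m.+1) -> l1sum X2 (ell1 R m.+1)})
    (S : {linear l1sum X2 (ell1 R m.+1) -> l1sum X1 (ell1 R m.+1)}) :
  cancel S T -> (forall y, `|S y| <= `|y|) ->
  (exists2 x : X1, x != 0 & `|x| <= `|(T (x, 0)).2 ord0 ord0|) \/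
  (exists i, 1 <= `|(T (0, delta_mx 0 i)).2 ord0 ord0|).
Proof.
move=> SK S1; apply: contrapT => /not_orP[noX noe].
pose lam z := (T z).2 ord0 ord0.
have lamD u v : lam (u + v) = lam u + lam v.
  by rewrite /lam linearD/= mxE.
have lamZ a u : lam (a *: u) = a * lam u.
  by rewrite /lam linearZ/= mxE.
have lam0 : lam 0 = 0 by rewrite -(scale0r 0) lamZ mul0r.
have lamX x : x != 0 -> `|lam (x, 0)| < `|x|.
  by move=> x0; rewrite ltNge; apply/negP => le; apply: noX; exists x.
have lame i : `|lam (0, delta_mx 0 i)| < 1.
  by rewrite ltNge; apply/negP => le; apply: noe; exists i.
have lamX' x : `|lam (x, 0)| <= `|x|.
  by have [->|/lamX/ltW//] := eqVneq x 0; rewrite [lam _]lam0 normr0.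
pose e : l1sum X2 (ell1 R m.+1) := (0, delta_mx 0 ord0).
have ne : `|e| = 1.
  rewrite l1sum_normE normr0 add0r ell1_normE (bigD1 ord0)//= mxE/=.
  rewrite normr1 big1 ?addr0// => i /negPf i0.
  by rewrite mxE i0 andbF normr0.
case E : (S e) => [w t].
have lamS : lam (S e) = 1 by rewrite /lam SK !mxE.
have nS : `|w| + \sum_i `|t ord0 i| <= 1.
  by rewrite -ne -ell1_normE; move: (S1 e); rewrite E l1sum_normE.
have lamt : lam (0, t) = \sum_i t ord0 i * lam (0, delta_mx 0 i).
  have lamsum (s : seq 'I_m.+1) (F : 'I_m.+1 -> ell1 R m.+1) :
      lam (0, \sum_(i <- s) F i) = \sum_(i <- s) lam (0, F i).
    elim: s => [|i s IH]; first by rewrite !big_nil [lam _]lam0.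
    by rewrite !big_cons -IH -lamD; congr (lam (_, _)); rewrite addr0.
  rewrite {1}[t]row_sum_delta lamsum; apply: eq_bigr => i _.
  by rewrite -lamZ; congr (lam (_, _)); rewrite /= scaler0.
have lamE : 1 = lam (w, 0) + lam (0, t).
  rewrite -lamS E -lamD; congr (lam (_, _)); rewrite ?addr0 ?add0r//.
have le1 : `|lam (0, t)| <= \sum_i `|t ord0 i| * `|lam (0, delta_mx 0 i)|.
  rewrite lamt; apply: le_trans (ler_norm_sum _ _ _) _.
  by apply: ler_sum => i _; rewrite normrM.
have le2 i : `|t ord0 i| * `|lam (0, delta_mx 0 i)| <= `|t ord0 i|.
  by rewrite ler_piMr// ltW.
(* The chain 1 = [lam (w, 0) + lam (0, t)], at most [|w|] plus the sum of [|t_i| |lam e_i|], at most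
   [|w|] plus the sum of [|t_i|], at most 1 consists of equalities. As each [|lam e_i| < 1], this
   forces [t = 0]. *)
have sum0 : \sum_i (`|t ord0 i| - `|t ord0 i| * `|lam (0, delta_mx 0 i)|) = 0.
  apply/eqP; rewrite eq_le sumr_ge0 ?andbT; last by move=> i _; rewrite subr_ge0.
  rewrite sumrB subr_le0.
  have := ler_norm (lam (w, 0)); have := ler_norm (lam (0, t)).
  have := lamX' w; lra.
have t0 : t = 0.
  apply/rowP => i; rewrite mxE; apply/eqP; rewrite -normr_eq0.
  move/eqP: sum0; rewrite psumr_eq0; last by move=> k _; rewrite subr_ge0.
  move=> /allP/(_ i (mem_index_enum _)) /=.
  rewrite -{1}[`|t ord0 i|]mulr1 -mulrBr mulf_eq0 => /orP[//|].
  by rewrite subr_eq0 => /eqP l1; have := lame i; rewrite -l1 ltxx.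
(* What remains is [lam (w, 0) = 1] with [|w| <= 1], against strictness on [X1]. *)
move: lamE; rewrite t0 [lam (0, 0)]lam0 addr0 => lamw.
have [w0|/lamX] := eqVneq w 0.
  by move: lamw; rewrite w0 [lam _]lam0 => /eqP; rewrite oner_eq0.
rewrite -lamw normr1 ltNge => /negP; apply; apply: le_trans nS.
by rewrite lerDl sumr_ge0.
Qed.

(** The induction must vary [X1], which may turn into [ell1 R 2], and [r], which grows slightly at
    each quotient by a vector of [X1]. *)
Lemma iso_within_l1sum_reduce (R : realType) (m : nat) (r : R)
    (X1 X2 : normedModType R) :
  has_dim 2 X1 -> has_dim 2 X2 -> r < 2 ->
  iso_within r (l1sum X1 (ell1 R m)) (l1sum X2 (ell1 R m)) ->
  banach_mazur X1 X2 <= r \/ banach_mazur (ell1 R 2) X2 <= r.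
Proof.
elim: m r X1 => [|m IH] r X1 d1 d2 r2 near.
  left; have {}near := iso_within_l1sum0 near.
  have [_ _ [_ [x x0]]] := area_form d1.
  have r1 := iso_within_ge1 x0 near.
  by apply: banach_mazur_le_within near; exact: le_trans ler01 r1.
have r1 : 1 <= r.
  have [_ _ [_ [x x0]]] := area_form d1.
  have z0 : ((x, 0) : l1sum X1 (ell1 R m.+1)) != 0.
    by apply: contra_neq x0 => -[].
  exact: iso_within_ge1 z0 near.
have r0 : 0 < r by exact: lt_le_trans ltr01 r1.
have [T [S [TK SK Tr S1]]] := near.
have T0 z : z != 0 -> T z != 0.
  by apply: contra_neq => Tz0; rewrite -(TK z) Tz0 linear0.
have quotT z : z != 0 -> `|z| <= `|(T z).2 ord0 ord0| ->
    line_quotient 1 (l1sum X2 (ell1 R m)) (T z).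
  move=> z0 zle; apply: (@cone_quotient _ _ _ _ ord0); first exact: T0.
  apply: le_trans (Tr z) _; apply: ler_pM => //; exact: ltW.
have [[x x0 xle]|[i ile]] := cone_vector SK S1.
  (* To absorb the loss, suppose the distance exceeds [r] and pick [s] strictly between [r] and both
     2 and that distance; the plane quotient is then used with distortion [s / r]. *)
  right; rewrite leNgt; apply/negP => lt_bm.
  have : r < Num.min 2 (banach_mazur (ell1 R 2) X2) by rewrite lt_min r2.
  set b := Num.min _ _ => /midf_lt [rs].
  move: ((r + b) / 2) rs => s rs; rewrite lt_min => /andP[s2 sbm].
  pose z : l1sum X1 (ell1 R m.+1) := (x, 0).
  have z0 : z != 0 by apply: contra_neq x0 => -[].
  have nz : `|z| = `|x| by rewrite l1sum_normE normr0 addr0.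
  have Tz : line_quotient 1 (l1sum X2 (ell1 R m)) (T z).
    by apply: quotT => //; rewrite nz.
  have a1 : 1 < s / r by rewrite ltr_pdivlMr// mul1r.
  have qz := plane_quotient m d1 x0 a1.
  have := iso_within_quotient (ltW r0) TK SK Tr S1 qz Tz.
  (* With [ell1 R 2] in place of [X1], both alternatives of the induction hypothesis bound the same
     distance by [s]. *)
  rewrite mulrC divfK ?gt_eqF// => /(IH _ _ (has_dim_ell1 R 2) d2 s2).
  by rewrite leNgt sbm => -[].
pose z : l1sum X1 (ell1 R m.+1) := (0, delta_mx 0 i).
have nz : `|z| = 1.
  rewrite l1sum_normE normr0 add0r ell1_normE (bigD1 i)//= mxE/= eqxx.
  rewrite normr1 big1 ?addr0// => k /negPf ki.
  by rewrite mxE ki andbF normr0.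
have z0 : z != 0 by rewrite -normr_eq0 nz oner_eq0.
have Tz : line_quotient 1 (l1sum X2 (ell1 R m)) (T z).
  by apply: quotT => //; rewrite nz.
have qz : line_quotient 1 (l1sum X1 (ell1 R m)) z.
  apply: (@cone_quotient _ _ _ _ i) => //.
  by rewrite nz /= mxE !eqxx normr1 mulr1 ler1n.
have := iso_within_quotient (ltW r0) TK SK Tr S1 qz Tz.
by rewrite mulr1; exact: IH.
Qed.

(** * The two inequalities between the distances *)

Lemma iso_within_dim (R : realType) (n : nat) (X Y : normedModType R)
    (T : {linear X -> Y}) (S : {linear Y -> X}) (x : X) :
  has_dim n X -> has_dim n Y -> x != 0 -> cancel T S -> cancel S T ->
  iso_within (opnorm T * opnorm S) X Y.
Proof.
move=> dX dY x0 TK SK.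
have [C C0 TC] := linear_bounded T dX; have [D D0 SD] := linear_bounded S dY.
exact: iso_within_opnorm x0 TK SK C0 TC D0 SD.
Qed.

(** Shows that the set defining [banach_mazur] is nonempty, as needed to bound its infimum from
    below. *)
Lemma linear_iso_dim (R : realType) (n : nat) (X Y : normedModType R) :
  has_dim n X -> has_dim n Y ->
  exists (T : {linear X -> Y}) (S : {linear Y -> X}), cancel T S /\ cancel S T.
Proof.
move=> /has_dimP[h [g [lh lg hK gK]]] /has_dimP[h' [g' [lh' lg' hK' gK']]].
have lT : linear (h' \o g) by move=> a u v; rewrite /= lg lh'.
have lS : linear (h \o g') by move=> a u v; rewrite /= lg' lh.
exists (linear_pack lT), (linear_pack lS).
by split=> x /=; rewrite ?hK' ?hK.
Qed.

Lemma banach_mazur_l1sum_le (R : realType) (m : nat) (X1 X2 : normedModType R) :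
  has_dim 2 X1 -> has_dim 2 X2 ->
  banach_mazur (l1sum X1 (ell1 R m)) (l1sum X2 (ell1 R m)) <=
  banach_mazur X1 X2.
Proof.
move=> d1 d2; have [_ _ [_ [x x0]]] := area_form d1.
apply: lb_le_inf.
  have [T [S [TK SK]]] := linear_iso_dim d1 d2.
  by exists (opnorm T * opnorm S), T, S.
move=> _ [T [S [TK SK ->]]].
have near := iso_within_dim d1 d2 x0 TK SK.
have r1 := iso_within_ge1 x0 near.
apply: banach_mazur_le_within; first exact: le_trans ler01 r1.
exact: iso_within_l1sum.
Qed.

Lemma banach_mazur_l1sum_ge (R : realType) (m : nat) (X1 X2 : normedModType R) :
  has_dim 2 X1 -> has_dim 2 X2 ->
  banach_mazur X1 X2 <= banach_mazur X2 (ell1 R 2) ->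
  banach_mazur X1 X2 <=
  banach_mazur (l1sum X1 (ell1 R m)) (l1sum X2 (ell1 R m)).
Proof.
move=> d1 d2 h2; have [_ _ [_ [x x0]]] := area_form d1.
have dZ1 := has_dim_l1sum m d1; have dZ2 := has_dim_l1sum m d2.
apply: lb_le_inf.
  have [T [S [TK SK]]] := linear_iso_dim dZ1 dZ2.
  by exists (opnorm T * opnorm S), T, S.
move=> _ [T [S [TK SK ->]]].
have z0 : ((x, 0) : l1sum X1 (ell1 R m)) != 0 by apply: contra_neq x0 => -[].
have near := iso_within_dim dZ1 dZ2 z0 TK SK.
(* If the product is at least 2, the hypothesis and Auerbach's bound already give the claim; below 2
   the reduction applies. *)
have [r2|] := ltP (opnorm T * opnorm S) 2; last first.
  by apply: le_trans; apply: le_trans h2 _; exact: banach_mazur_ell1_le2.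
have [//|] := iso_within_l1sum_reduce d1 d2 r2 near.
by rewrite banach_mazurC; exact: le_trans.
Qed.

Theorem theorem1p7 (R : realType) (X1 X2 : normedModType R)
  (dimX1 : has_dim 2 X1) (dimX2 : has_dim 2 X2)
  (hX : banach_mazur X1 (ell1 R 2) >= banach_mazur X1 X2 \/
        banach_mazur X2 (ell1 R 2) >= banach_mazur X1 X2)
  (m : nat) (hm : (1 <= m)%N) :
  banach_mazur (l1sum X1 (ell1 R m)) (l1sum X2 (ell1 R m)) =
  banach_mazur X1 X2.
Proof.
apply/eqP; rewrite eq_le banach_mazur_l1sum_le//=.
case: hX => hX; last exact: banach_mazur_l1sum_ge.
(* By symmetry of the distance, exchanging [X1] and [X2] turns the first alternative into the
   second. *)
rewrite banach_mazurC [leRHS]banach_mazurC.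
by apply: banach_mazur_l1sum_ge; rewrite // banach_mazurC.
Qed.
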